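(* Given a small field $K$ and a small, nonzero $K$-vector space $V$, the $\mathfrak{Small}$-ary double centralizer clone $(\Sigma^V)^{\perp\perp(\mathfrak{Small})}$ of $V$ is equal to the clone of $\mathfrak{Small}$-ary derived operations $\langle \Sigma^V\rangle$ of $V$, where $\Sigma$ is the usual signature for $K$-vector spaces.
   Context: Fix a Grothendieck universe $\mathfrak{Small}$, i.e. the set of all sets of rank less than a fixed inaccessible cardinal; its elements are called small sets. $\Sigma$ is the signature consisting of a binary operation symbol $+$, a constant symbol $0$, a unary operation symbol $-$, and a unary operation symbol $c$ for each $c\in K$ (scalar multiplication by $c$). $\Sigma^V$ denotes the set of the corresponding basic operations on $V$. A $\mathfrak{Small}$-ary operation on a set $A$ is a map $A^X \to A$ with $X$ a small set (its arity); nullary operations are allowed. A $\mathfrak{Small}$-ary clone on $A$ is a set $F$ of $\mathfrak{Small}$-ary operations on $A$ that contains all projections $\pi_x:A^X\to A$ ($X$ small, $x\in X$) and is such that for all small $X,Y$, every $f:A^Y\to A$ in $F$ and every family $g_y:A^X\to A$ $(y\in Y)$ in $F$, the composite $f\circ(g_y)_{y\in Y}:A^X\to A$ lies in $F$. The clone of $\mathfrak{Small}$-ary derived operations $\langle\Sigma^V\rangle$ is the smallest $\mathfrak{Small}$-ary clone on $V$ containing $\Sigma^V$. Operations $f:A^X\to A$ and $g:A^Y\to A$ commute, written $f\perp g$, if for every matrix $a=(a_{xy})\in A^{X\times Y}$ one has $g\bigl((f((a_{xy})_{x\in X}))_{y\in Y}\bigr)=f\bigl((g((a_{xy})_{y\in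 Y}))_{x\in X}\bigr)$. For a set $G$ of $\mathfrak{Small}$-ary operations on $A$, $G^{\perp(\mathfrak{Small})}$ is the set of all $\mathfrak{Small}$-ary operations $f$ on $A$ with $f\perp g$ for all $g\in G$, and $G^{\perp\perp(\mathfrak{Small})}$ is the result of applying $(-)^{\perp(\mathfrak{Small})}$ twice to $G$. *)

(* Defs.v *)
From HB Require Import structures.
From mathcomp Require Import all_boot all_order all_algebra.

Set Implicit Arguments.
Unset Strict Implicit.
Unset Printing Implicit Defensive.

Import GRing.Theory.
Local Open Scope ring_scope.

(* The Grothendieck universe of small sets is rendered by one fixed universe of
   types: [Small] is monomorphic, so every occurrence denotes the same universe
   level, which contains the carriers of the structures as well as all arities. *)
Definition Small := Type.

Record operation (A : Small) := Operation {
  arity : Small;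
  op_fun :> (arity -> A) -> A
}.

Definition opset (A : Small) := operation A -> Prop.

Definition proj (A X : Small) (x : X) : operation A :=
  Operation (fun a : X -> A => a x).

Definition compose (A X Y : Small) (f : (Y -> A) -> A)
    (g : Y -> (X -> A) -> A) : operation A :=
  Operation (fun a : X -> A => f (fun y => g y a)).

Record is_clone (A : Small) (F : opset A) : Prop := IsClone {
  clone_proj : forall (X : Small) (x : X), F (proj A x);
  clone_compose : forall (X Y : Small) (f : (Y -> A) -> A)
      (g : Y -> (X -> A) -> A),
    F (Operation f) -> (forall y, F (Operation (g y))) -> F (compose f g)
}.

Definition generated_clone (A : Small) (G : opset A) : opset A :=
  fun h => forall F : opset A,
    is_clone F -> (forall g, G g -> F g) -> F h.

Definition commute (A : Small) (f g : operation A) : Prop :=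
  forall a : arity f -> arity g -> A,
    g (fun y => f (fun x => a x y)) = f (fun x => g (fun y => a x y)).

Definition centralizer (A : Small) (G : opset A) : opset A :=
  fun f => forall g, G g -> commute f g.

Definition double_centralizer (A : Small) (G : opset A) : opset A :=
  centralizer (centralizer G).

Inductive vect_symbol (K : Small) : Small :=
  | AddSym
  | ZeroSym
  | OppSym
  | ScaleSym of K.

Definition symbol_arity (K : Small) (s : vect_symbol K) : nat :=
  match s with
  | AddSym => 2
  | ZeroSym => 0
  | OppSym => 1
  | ScaleSym _ => 1
  end.

Definition symbol_interp (K : fieldType) (V : lmodType K) (s : vect_symbol K) :
    ('I_(symbol_arity s) -> V) -> V :=
  match s return ('I_(symbol_arity s) -> V) -> V with
  | AddSym => fun v => v ord0 + v ord_max
  | ZeroSym => fun _ => 0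
  | OppSym => fun v => - v ord0
  | ScaleSym c => fun v => c *: v ord0
  end.

Definition vect_ops (K : fieldType) (V : lmodType K) : opset V :=
  fun h => exists s : vect_symbol K, h = Operation (@symbol_interp K V s).

Arguments vect_ops {K} V _.

(* Main.v *)
(** Regard [f : V^X -> V] in the double centralizer as a vector of the
    space [W] of all maps [V^X -> V].  A linear map [g : W -> V] is an operation
    of arity [V^X] that commutes with the vector space operations, hence with [f];
    on the matrix [(y x)] indexed by [x : X], [y : V^X] this says
    [g f = f (x |-> g (proj x))].  If [f] were outside the span of the
    projections, some [g] would kill all of them but not [f], whereas the
    right-hand side would be [f 0 = 0].  So [f] is a finite linear combination
    of projections. *)
Require Import Defs.
From HB Require Import structures.
From mathcomp Require Import all_boot all_order all_algebra.
From mathcomp Require Import boolp classical_sets functions.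

Set Implicit Arguments.
Unset Strict Implicit.
Unset Printing Implicit Defensive.

Import GRing.Theory.
Local Open Scope ring_scope.

Lemma commute_sym (A : Small) (f g : operation A) : Defs.commute f g -> Defs.commute g f.
Proof. by move=> fg a; rewrite (fg (fun x y => a y x)). Qed.

Lemma centralizer_clone (A : Small) (G : opset A) : is_clone (centralizer G).
Proof.
split=> [X x g _ //|X Y f g fG gG h hG a /=].
(* [h] is moved past the outer [f] first, then past each [g z] under [f]. *)
apply: etrans (fG h hG (fun z y => g z (a^~ y))) _ => /=; congr f.
by apply/funext => z; exact: (gG z h hG a).
Qed.

(** The double centralizer is itself a centralizer, hence a clone, and it contains [G] because
    commuting is symmetric. *)
Lemma generated_clone_sub_double_centralizer (A : Small) (G : opset A)
    (h : operation A) :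
  generated_clone G h -> double_centralizer G h.
Proof.
move=> /(_ (double_centralizer G)); apply; first exact: centralizer_clone.
by move=> g Gg f /(_ g Gg); exact: commute_sym.
Qed.

Section Separation.
Variables (K : fieldType) (W : lmodType K).

Definition subspace (U : set W) : Prop :=
  U 0 /\ forall (c : K) u v, U u -> U v -> U (c *: u + v).

Lemma subspaceZ (U : set W) c u : subspace U -> U u -> U (c *: u).
Proof. by case=> U0 UL Uu; rewrite -[_ *: _]addr0; apply: UL. Qed.

Lemma subspaceB (U : set W) u v : subspace U -> U u -> U v -> U (u - v).
Proof. by move=> sU Uu Uv; rewrite addrC -scaleN1r; apply: sU.2. Qed.

(** Such an [M] is to serve as the kernel of a functional that does not vanish at [w]. *)
Lemma maximal_subspace_avoiding (S : set W) (w : W) :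
  subspace S -> ~ S w ->
  exists M : set W, [/\ subspace M, S `<=` M, ~ M w &
    forall N, subspace N -> M `<=` N -> ~ N w -> N `<=` M]%classic.
Proof.
move=> sS Sw.
(* Taking the union with [S] makes the empty chain harmless in Zorn's lemma. *)
pose P (A : set W) := subspace (S `|` A)%classic /\ ~ (S `|` A)%classic w.
have [F FP Ftot|A [[sA Aw] Amax]] := @Zorn_bigcup W P.
  split; last first.
    by case=> [//|[A FA Aw]]; have [_] := FP A FA; apply; right.
  split; first by left; exact: sS.1.
  have inU A u : F A -> (S `|` A)%classic u ->
      (S `|` \bigcup_(X in F) X)%classic u.
    by move=> FA [Su|Au]; [left|right; exists A].
  move=> c u v [Su|[A FA Au]] [Sv|[B FB Bv]].
  - by left; apply: sS.2.
  - by apply: (inU B) => //; apply: (FP B FB).1.2; [left|right].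
  - by apply: (inU A) => //; apply: (FP A FA).1.2; [right|left].
  - have [AB|BA] := Ftot A B FA FB.
      by apply: (inU B) => //; apply: (FP B FB).1.2; right => //; exact: AB.
    by apply: (inU A) => //; apply: (FP A FA).1.2; right => //; exact: BA.
exists (S `|` A)%classic; split=> // N sN AN Nw u Nu.
have SN : (S `|` N)%classic = N.
  by apply/seteqP; split=> [z [Sz|//]|z Nz]; [apply: AN; left|right].
apply: contrapT => Au; apply: (Amax N); last by rewrite /P SN.
split=> [z Az|NA]; first by apply: AN; right.
by apply: Au; right; exact: NA.
Qed.

(** A maximal subspace [M] avoiding [w] is a complement of the line [K w]; [g u] is the coefficient
    of [w] in the resulting decomposition of [u]. *)
Lemma separating_functional (S : set W) (w : W) :
  subspace S -> ~ S w ->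
  exists g : W -> K, [/\ forall c u v, g (c *: u + v) = c * g u + g v,
    forall u, S u -> g u = 0 & g w = 1].
Proof.
move=> sS Sw; have [M [sM SM Mw Mmax]] := maximal_subspace_avoiding sS Sw.
have decomp u : exists c, M (u - c *: w).
  have [Mu|Mu] := pselect (M u); first by exists 0; rewrite scale0r subr0.
  (* [N] is [M + K u]. By maximality it contains [w], since otherwise [u] would lie in [M]; solving
     [w - c *: u] in [M] for [u] gives the coefficient [c^-1]. *)
  pose N : set W := fun z => exists c, M (z - c *: u).
  have sN : subspace N.
    split; first by exists 0; rewrite scale0r subr0; exact: sM.1.
    move=> c y z [a My] [b Mz]; exists (c * a + b).
    rewrite scalerDl -scalerA opprD addrACA -scalerBr; exact: sM.2.
  have [[c Mwc]|Nw] := pselect (N w); last first.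
    case: Mu; apply: (Mmax N) => // [z Mz|].
      by exists 0; rewrite scale0r subr0.
    by exists 1; rewrite scale1r subrr; exact: sM.1.
  have c0 : c != 0.
    by apply/eqP => c0; apply: Mw; rewrite c0 scale0r subr0 in Mwc.
  exists c^-1; have := subspaceZ (- c^-1) sM Mwc.
  by rewrite scalerBr !scaleNr opprK scalerA mulVf // scale1r addrC.
(* Two different coefficients would put a nonzero multiple of [w] into [M]. *)
have uniq c d u : M (u - c *: w) -> M (u - d *: w) -> c = d.
  move=> Mc Md; apply: contrapT => /eqP; rewrite -subr_eq0 => cd.
  apply: Mw; have := subspaceZ (c - d)^-1 sM (subspaceB sM Md Mc).
  rewrite [_ - _ - _]addrC opprB addrA subrK -scalerBl scalerA mulVf //.
  by rewrite scale1r.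
have [g gP] := choice decomp.
exists g; split=> [c u v|u Su|].
- apply: uniq (gP _) _.
  by rewrite scalerDl -scalerA opprD addrACA -scalerBr; apply: sM.2.
- by apply: uniq (gP _) _; rewrite scale0r subr0; exact: SM.
- by apply: uniq (gP _) _; rewrite scale1r subrr; exact: sM.1.
Qed.

End Separation.

Section VectorSpace.
Variables (K : fieldType) (V : lmodType K).

Lemma linear_centralizes (Y : Small) (g : (Y -> V) -> V) :
  (forall c u v, g (fun y => c *: u y + v y) = c *: g u + g v) ->
  centralizer (vect_ops V) (Operation g).
Proof.
move=> gL.
have g0 : g (fun=> 0) = 0.
  apply: (addIr (g (fun=> 0))); rewrite add0r -[X in X + _]scale1r -gL.
  by congr g; apply/funext => y; rewrite scaler0 addr0.
have gZ c u : g (fun y => c *: u y) = c *: g u.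
  rewrite -[RHS]addr0 -g0 -gL; congr g.
  by apply/funext => y; rewrite addr0.
move=> h [[|||c] ->] a /=; last by rewrite gZ.
- rewrite -[X in X + _]scale1r -gL; congr g.
  by apply/funext => y; rewrite scale1r.
- by rewrite g0.
- rewrite -scaleN1r -gZ; congr g.
  by apply/funext => y; rewrite scaleN1r.
Qed.

(** This puts the constant [0] in the centralizer, so every [f] in the double centralizer sends the
    zero family to [0]. *)
Lemma zero_centralizes :
  centralizer (vect_ops V) (Operation (@symbol_interp K V (@ZeroSym K))).
Proof.
move=> h [[|||c] ->] a //=; first exact: addr0.
- exact: oppr0.
- exact: scaler0.
Qed.

(** A list of terms, possibly with repeated indices, keeps the sum finite for arbitrary [X] and
    makes addition a concatenation. *)
Definition lincomb (X : Type) (s : seq (K * X)) (a : X -> V) : V :=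
  \sum_(p <- s) p.1 *: a p.2.

Lemma lincomb_derived (X : Small) (s : seq (K * X)) :
  generated_clone (vect_ops V) (Operation (lincomb s)).
Proof.
move=> F cF FV; elim: s => [|[c x] s IH].
  have F0 := FV _ (ex_intro _ (@ZeroSym K) erefl).
  (* Composing the nullary [0] with an empty family raises its arity to [X]; [g] is a dummy, as
     ['I_0] has no elements. *)
  have := clone_compose cF F0 (g := fun=> @lincomb X [::]) _.
  rewrite (_ : compose _ _ = Operation (@lincomb X [::])).
    by apply; case.
  by congr Operation; apply/funext => a; rewrite /lincomb big_nil.
have Fc : F (Operation (fun a : X -> V => c *: a x)).
  have := clone_compose cF (FV _ (ex_intro _ (ScaleSym c) erefl))
    (g := fun _ (a : X -> V) => a x).
  by apply=> _; exact: (clone_proj cF x).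
pose g (i : 'I_2) : (X -> V) -> V :=
  if val i == 0%N then fun a => c *: a x else lincomb s.
have := clone_compose cF (FV _ (ex_intro _ (@AddSym K) erefl)) (g := g).
rewrite (_ : compose _ _ = Operation (lincomb ((c, x) :: s))).
  by apply=> i; rewrite /g; case: ifP.
by congr Operation; apply/funext => a; rewrite /lincomb big_cons.
Qed.

Lemma lincomb_subspace (X : Type) :
  subspace (fun h : (X -> V) -> V => exists s : seq (K * X), h = lincomb s).
Proof.
split; first by exists [::]; apply/funext => a; rewrite /lincomb big_nil.
move=> c _ _ [s ->] [t ->].
exists ([seq (c * p.1, p.2) | p <- s] ++ t); apply/funext => a.
rewrite /lincomb big_cat big_map /= [LHS]/(_ *: _ + _) scaler_sumr.
by congr (_ + _); apply: eq_bigr => p _; rewrite scalerA.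
Qed.

Lemma double_centralizer_lincomb (X : Small) (f : (X -> V) -> V) :
  (exists v : V, v != 0) -> double_centralizer (vect_ops V) (Operation f) ->
  exists s : seq (K * X), f = lincomb s.
Proof.
move=> [v v0] fC; apply: contrapT => fS.
have [g [gL gS gf]] := separating_functional (lincomb_subspace X) fS.
(* Multiplying the fixed nonzero [v] by [g] turns the functional into an operation on [V] of arity
   [X -> V]. *)
have gC : centralizer (vect_ops V)
    (Operation (fun u : (X -> V) -> V => g u *: v)).
  apply: linear_centralizes => c u w.
  by rewrite [g _](gL c u w) scalerDl scalerA.
have f0 : f (fun=> 0) = 0.
  by have /(_ (fun _ _ => 0)) := fC _ zero_centralizes.
have gproj x : g (fun y => y x) = 0.
  apply: gS; exists [:: (1, x)]; apply/funext => y.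
  by rewrite /lincomb big_seq1 scale1r.
have /= := fC _ gC (fun x y => y x).
rewrite [g _]gf scale1r => vE; move/eqP: v0; apply; rewrite vE -[RHS]f0.
by congr f; apply/funext => x; rewrite gproj scale0r.
Qed.

End VectorSpace.

Theorem theorem7p1 (K : fieldType) (V : lmodType K)
    (V_nonzero : exists v : V, v != 0) :
  double_centralizer (vect_ops V) = generated_clone (vect_ops V).
Proof.
apply/funext => -[X f]; apply/propext; split; last first.
  exact: generated_clone_sub_double_centralizer.
move=> /(double_centralizer_lincomb V_nonzero)[s ->].
exact: lincomb_derived.
Qed.
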